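(* Let $\alpha>1$ and consider the continuous speed-scaling problem with power function $P(s)=s^{\alpha}$ described in the context. There is a single job order (a ''universal sequence'') $\pi$ such that for every energy budget $E>0$ there is an optimal solution of the speed-scaling problem with budget $E$ that processes the jobs in the order $\pi$. Moreover, $\pi$ is obtained by reversing an optimal permutation $\pi'$ for the following single-machine problem on a machine of constant speed $1$: each job $j$ has processing time $w_j$ and weight $v_j$, and one minimizes $\sum_j v_j\, C_j^{(\alpha-1)/\alpha}$, where $C_j$ is the completion time of job $j$ when jobs are processed in order $\pi'$ without idle time.
   Context: Jobs $1,\dots,n$ have work volumes $v_j\ge 0$ and weights $w_j\ge 0$. In the continuous speed-scaling problem with energy budget $E$, an algorithm chooses a job order and at each time a machine speed $s\ge 0$ (any nonnegative real); running at speed $s$ consumes power $P(s)=s^{\alpha}$, and the total energy (power integrated over time) must be at most $E$. Jobs are processed nonpreemptively in the chosen order, a job of work volume $v$ needing total processed work $v$. The objective is to minimize $\sum_j w_jC_j$, with $C_j$ the completion time of job $j$.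
   Formalization: Jobs of weight 0 need not be completed in finite time (they then contribute 0 to the objective); if they had to be, an optimal solution need not exist, e.g. for jobs (v,w) = (1,1), (1,0). For positive weights the model is unchanged. *)

(* Defs.v *)
From HB Require Import structures.
From mathcomp Require Import all_boot all_order all_algebra all_fingroup.
From mathcomp Require Import all_classical all_reals all_analysis.

Set Implicit Arguments.
Unset Strict Implicit.
Unset Printing Implicit Defensive.

Import Order.TTheory GRing.Theory Num.Theory.

Local Open Scope classical_set_scope.
Local Open Scope ring_scope.

(* A job order is a permutation [pi : 'S_n], [pi k] being the job in position
   [k]; hence [(pi^-1)%g j] is the position of job [j]. *)

Definition rev_order (n : nat) (pi : 'S_n) : 'S_n :=
  perm (inj_comp (@perm_inj _ pi) (@rev_ord_inj n)).

(* Total amount [a] of the jobs up to and including [j] in the order [pi]. *)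
Definition total_upto (R : realType) (n : nat) (a : 'I_n -> R) (pi : 'S_n)
    (j : 'I_n) : R :=
  \sum_(i < n | ((pi^-1)%g i <= (pi^-1)%g j)%N) a i.

(* Machine of constant speed 1 without idle time: job [j] completes when the
   processing times [p] of the jobs up to [j] have elapsed. *)
Definition unit_speed_cost (R : realType) (n : nat) (f : R -> R)
    (p wt : 'I_n -> R) (pi : 'S_n) : R :=
  \sum_(j < n) wt j * f (total_upto p pi j).

Definition unit_speed_optimal (R : realType) (n : nat) (f : R -> R)
    (p wt : 'I_n -> R) (pi : 'S_n) : Prop :=
  forall sigma : 'S_n, unit_speed_cost f p wt pi <= unit_speed_cost f p wt sigma.

(* A solution of the speed-scaling problem is a job order together with a speed
   profile [s]; only the values [s t] with [0 <= t] matter. *)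

Definition work_done (R : realType) (s : R -> R) (t : R) : \bar R :=
  (\int[lebesgue_measure]_(x in `[0%R, t]) (s x)%:E)%E.

Definition energy (R : realType) (P s : R -> R) : \bar R :=
  (\int[lebesgue_measure]_(x in `[0%R, +oo[) (P (s x))%:E)%E.

(* The first time at which the work of all jobs up to [j] has been processed;
   it is [+oo] when this never happens. *)
Definition completion_time (R : realType) (n : nat) (v : 'I_n -> R)
    (pi : 'S_n) (s : R -> R) (j : 'I_n) : \bar R :=
  ereal_inf [set t%:E | t in
    [set t : R | 0 <= t /\ ((total_upto v pi j)%:E <= work_done s t)%E]].

Definition weighted_completion (R : realType) (n : nat) (v w : 'I_n -> R)
    (pi : 'S_n) (s : R -> R) : \bar R :=
  (\sum_(j < n) (w j)%:E * completion_time v pi s j)%E.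

(* Every job of positive weight must be completed. A job of weight 0 may be
   postponed forever, contributing [0 * +oo = 0] to the objective: if it had to
   be completed, the infimum would not be attained in general, as such a job of
   positive volume, put last, needs a positive but arbitrarily small amount of
   energy. *)
Record feasible (R : realType) (n : nat) (P : R -> R) (E : R)
    (v w : 'I_n -> R) (pi : 'S_n) (s : R -> R) : Prop := Feasible {
  feasible_measurable : measurable_fun (`[0, +oo[ : set R) s ;
  feasible_nonneg : forall t, 0 <= t -> 0 <= s t ;
  feasible_energy : (energy P s <= E%:E)%E ;
  feasible_completed :
    forall j, 0 < w j -> (completion_time v pi s j < +oo)%E
}.

Definition optimal_solution (R : realType) (n : nat) (P : R -> R) (E : R)
    (v w : 'I_n -> R) (pi : 'S_n) (s : R -> R) : Prop :=
  feasible P E v w pi s /\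
  forall (sigma : 'S_n) (u : R -> R), feasible P E v w sigma u ->
    (weighted_completion v w pi s <= weighted_completion v w sigma u)%E.

Definition universal_sequence (R : realType) (n : nat) (P : R -> R)
    (v w : 'I_n -> R) (pi : 'S_n) : Prop :=
  forall E : R, 0 < E -> exists s : R -> R, optimal_solution P E v w pi s.

(* Main.v *)
(* Fix an order and let [W_j] be the total weight of the jobs from [j] on. With
   [W] the weight of the jobs not yet completed, the objective is the integral of
   [W] over time, so Young's inequality
     [alpha sigma^(alpha-1) s <= s^alpha + (alpha-1) sigma^alpha] at the speed
   [sigma = lam W^(1/alpha)] gives, after integration,
     [alpha lam^(alpha-1) A <= E + (alpha-1) lam^alpha * objective],
   where [A = \sum_j v_j W_j^((alpha-1)/alpha)], with equality for the speed
   profile [sigma].  Choosing [lam] with [lam^(alpha-1) A = E], the order has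
   optimal value [A / lam = (A^alpha / E)^(1/(alpha-1))].  Hence, whatever [E], the
   best orders are those minimizing [A], and [A] is the cost of the reversed order
   in the unit-speed problem. *)

Require Import Defs.
From HB Require Import structures.
From mathcomp Require Import all_boot all_order all_algebra all_fingroup.
From mathcomp Require Import all_classical all_reals all_analysis.
From mathcomp Require Import measurable_realfun ring lra.

Set Implicit Arguments.
Unset Strict Implicit.
Unset Printing Implicit Defensive.

Import Order.TTheory GRing.Theory Num.Theory.

Local Open Scope classical_set_scope.
Local Open Scope ring_scope.

(** * Summation by parts along an order of the jobs *)

Section Telescoping.
Variables (R : realType) (T : finType) (pos : T -> nat).
Hypothesis pos_inj : injective pos.
Implicit Types (f : R -> R) (w d : T -> R) (j : T).

Definition weight_from w j : R := \sum_(i | (pos j <= pos i)%N) w i.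

Definition weight_after w j : R := \sum_(i | (pos j < pos i)%N) w i.

(** The drop in [f] of the remaining weight when [j] completes; such drops are the coefficients of
    the step functions of time used below. *)
Definition increment f w j : R := f (weight_from w j) - f (weight_after w j).

Lemma weight_from_after w j : weight_from w j = w j + weight_after w j.
Proof.
rewrite /weight_from (bigD1 j) //=; congr (_ + _); apply: eq_bigl => i.
by rewrite ltn_neqAle andbC; congr (_ && _); rewrite eq_sym (inj_eq pos_inj).
Qed.

Lemma weight_from_ge0 w j : (forall i, 0 <= w i) -> 0 <= weight_from w j.
Proof. by move=> w0; apply: sumr_ge0. Qed.

Lemma weight_after_ge0 w j : (forall i, 0 <= w i) -> 0 <= weight_after w j.
Proof. by move=> w0; apply: sumr_ge0. Qed.

Lemma weight_from_le w i j : (forall i, 0 <= w i) -> (pos i <= pos j)%N ->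
  w j <= weight_from w i.
Proof.
move=> w0 ij; rewrite /weight_from (bigD1 j) //= lerDl.
by apply: sumr_ge0.
Qed.

Lemma increment0 f w j : w j = 0 -> increment f w j = 0.
Proof. by rewrite /increment weight_from_after => ->; rewrite add0r subrr. Qed.

Lemma increment_ge0 f w j : (forall i, 0 <= w i) ->
  (forall x y, 0 <= x -> x <= y -> f x <= f y) -> 0 <= increment f w j.
Proof.
move=> w0 f_homo; rewrite subr_ge0; apply: f_homo; first exact: weight_after_ge0.
by rewrite weight_from_after lerDr.
Qed.

(** Removing the first job [j] of an up-closed [S] leaves exactly the jobs after [j], so the
    increments telescope down to [f 0 = 0]. *)
Lemma sum_increment f w (S : {set T}) : f 0 = 0 ->
    (forall i j, (pos i <= pos j)%N -> i \in S -> j \in S) ->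
  \sum_(j in S) increment f w j = f (\sum_(j in S) w j).
Proof.
move=> f0; have [m] := ubnP #|S|; elim: m S => // m IHm S Sm S_up.
have [->|/set0Pn[i0 i0S]] := eqVneq S finset.set0; first by rewrite !big_set0.
have [j + j_min] := arg_minnP pos i0S; rewrite -[_ j]/(j \in S) => jS.
have S_from i : (i \in S) = (pos j <= pos i)%N.
  by apply/idP/idP => [/j_min //|/S_up]; apply.
have S_after i : (i \in S :\ j) = (pos j < pos i)%N.
  by rewrite !inE S_from ltn_neqAle (inj_eq pos_inj) eq_sym.
rewrite (big_setD1 j jS) /= IHm.
- rewrite /increment /weight_from /weight_after.
  by rewrite (eq_bigl _ _ S_from) (eq_bigl _ _ S_after) subrK.
- by move: Sm; rewrite (cardsD1 j S) jS.
- by move=> i k ik; rewrite !S_after => /leq_trans; apply.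
Qed.

(** With [g] the indicator of the jobs still running at a given time, this makes [f] of the
    remaining weight linear in indicators. A job of weight 0 has increment 0, so [g] may be
    arbitrary there. *)
Lemma sum_increment_indicator f w (S : pred T) (g : T -> R) : f 0 = 0 ->
    (forall i j, (pos i <= pos j)%N -> S i -> S j) ->
    (forall j, w j != 0 -> g j = (S j)%:R) ->
  \sum_j increment f w j * g j = f (\sum_j w j * g j).
Proof.
move=> f0 S_up gS.
have sumS h : (forall j, w j = 0 -> h j = 0) ->
    \sum_j h j * g j = \sum_(j in [set j | S j]%SET) h j.
  move=> hw; rewrite [RHS]big_mkcond /=; apply: eq_bigr => j _.
  have [/hw ->|/gS ->] := eqVneq (w j) 0; first by rewrite mul0r if_same.
  by rewrite finset.inE; case: (S j); rewrite (mulr1, mulr0).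
rewrite sumS; last by move=> j; apply: increment0.
rewrite sumS // sum_increment // => i j ij; rewrite !finset.inE; exact: S_up.
Qed.

(** Once the sums are exchanged, [d i] is multiplied by the increments of all jobs from [i] on, and
    these telescope. *)
Lemma sum_increment_exchange f w d (Q : pred T) : f 0 = 0 ->
  \sum_j increment f w j * \sum_(i | (pos i <= pos j)%N && Q i) d i =
  \sum_(i | Q i) d i * f (weight_from w i).
Proof.
move=> f0; under eq_bigr do rewrite mulr_sumr.
rewrite (exchange_big_dep Q) /=; last by move=> ? ? _ /andP[].
apply: eq_bigr => i Qi; rewrite -mulr_suml mulrC; congr (_ * _).
transitivity (\sum_(j in [set j | (pos i <= pos j)%N]%SET) increment f w j).
  by apply: eq_bigl => j; rewrite finset.inE Qi andbT.
rewrite sum_increment //; last first.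
  by move=> j k jk; rewrite !finset.inE => /leq_trans; apply.
by congr f; apply: eq_bigl => j; rewrite finset.inE.
Qed.

Lemma increment_id w : increment id w =1 w.
Proof. by move=> j; rewrite /increment weight_from_after addrK. Qed.

End Telescoping.

(** * Integrals of step functions of time *)

Lemma integral_sum_indic_itv (R : realType) (I : finType) (D : set R)
    (a T : I -> R) (s : R -> R) :
    measurable D -> measurable_fun D s ->
    (forall x, D x -> 0 <= s x) -> (forall i, 0 <= a i) ->
  (\int[lebesgue_measure]_(x in D)
     (\sum_i a i * \1_(`[0%R, T i] : set R) x * s x)%:E =
   \sum_i (a i)%:E *
     \int[lebesgue_measure]_(x in D `&` `[0%R, T i]) (s x)%:E)%E.
Proof.
move=> mD ms s0 a0.
under eq_integral do rewrite -sumEFin.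
have mterm i : measurable_fun D
    (fun x => \1_(`[0%R, T i] : set R) x * s x).
  apply: measurable_funM => //.
have term0 i x : D x -> (0 <= (\1_(`[0%R, T i] : set R) x * s x)%:E)%E.
  by move=> Dx; rewrite lee_fin mulr_ge0 // s0.
under eq_integral => x _.
  under eq_bigr do rewrite -mulrA EFinM.
  over.
rewrite ge0_integral_sum //.
- apply: eq_bigr => i _; rewrite ge0_integralZl_EFin //; first congr (_ * _)%E.
    rewrite integral_mkcondr; apply: eq_integral => x _.
    rewrite patchE indicE; case: ifP => _; first by rewrite mul1r.
    by rewrite mul0r.
    by move=> x; apply: term0.
  by apply/measurable_EFinP; apply: mterm.
- by move=> i; apply: measurable_funeM; apply/measurable_EFinP; apply: mterm.
- by move=> i x Dx; apply: mule_ge0; rewrite ?lee_fin // -lee_fin term0.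
Qed.

Lemma setI_itv0y_itv0 (R : realType) (T : R) :
  [set` `[0, +oo[] `&` [set` `[0, T]] = [set` `[0, T]] :> set R.
Proof.
apply/seteqP; split => x /=; first by case.
by rewrite !in_itv /= => /andP[-> ->].
Qed.

Lemma integral_itv0_cst1 (R : realType) (T : R) : 0 <= T ->
  (\int[lebesgue_measure]_(x in `[0%R, T]) 1%:E = T%:E)%E.
Proof.
move=> T0; rewrite integral_cst // mul1e /= lebesgue_measure_itv /= lte_fin.
have [_|] := ltP 0 T; first by rewrite -EFinB subr0.
by move=> T0'; congr _%:E; apply/le_anti; rewrite T0.
Qed.

Lemma le_work_done (R : realType) (s : R -> R) (t u : R) :
    measurable_fun (`[0, +oo[ : set R) s -> (forall t, 0 <= t -> 0 <= s t) ->
  t <= u -> (work_done s t <= work_done s u)%E.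
Proof.
move=> ms s0 tu; apply: ge0_subset_integral => //.
- apply/measurable_EFinP; apply: measurable_funS ms => // x /=.
  by rewrite !in_itv /= => /andP[->].
- by move=> x /=; rewrite in_itv /= => /andP[x0 _]; rewrite lee_fin s0.
- by move=> x /=; rewrite !in_itv /= => /andP[-> /le_trans]; apply.
Qed.

(* Young's inequality for the exponents [alpha] and [alpha / (alpha - 1)]; it is
   an equality for the speed [s = lam * W `^ (1 / alpha)]. *)
Lemma power_tangent (R : realType) (alpha lam W s : R) :
    1 < alpha -> 0 < lam -> 0 <= W -> 0 <= s ->
  alpha * lam `^ (alpha - 1) * (W `^ ((alpha - 1) / alpha) * s) <=
  s `^ alpha + (alpha - 1) * lam `^ alpha * W.
Proof.
move=> a1 lam0 W0 s0.
have a0 : alpha != 0 by lra.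
have a10 : alpha - 1 != 0 by lra.
have := @conjugate_powR R s (lam `^ (alpha - 1) * W `^ ((alpha - 1) / alpha))
  alpha (alpha / (alpha - 1)) s0.
rewrite mulr_ge0 ?powR_ge0 // => /(_ isT).
rewrite (_ : 0 < alpha); last by lra.
rewrite divr_gt0; [|lra|lra] => /(_ isT isT).
have -> : alpha^-1 + (alpha / (alpha - 1))^-1 = 1 by field; apply/andP; split.
move=> /(_ erefl).
rewrite powRM ?powR_ge0 // -!powRrM.
have -> : (alpha - 1) * (alpha / (alpha - 1)) = alpha by field.
have -> : (alpha - 1) / alpha * (alpha / (alpha - 1)) = 1.
  by field; apply/andP; split.
rewrite powRr1 // => young.
have {young} := ler_wpM2l (ltW (lt_trans ltr01 a1)) young.
have -> : alpha * (s * (lam `^ (alpha - 1) * W `^ ((alpha - 1) / alpha))) =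
  alpha * lam `^ (alpha - 1) * (W `^ ((alpha - 1) / alpha) * s) by ring.
move=> /le_trans; apply; rewrite le_eqVlt; apply/orP; left; apply/eqP.
by field; apply/andP; split.
Qed.

(** * Positions of jobs and reversed orders *)

Definition position (n : nat) (pi : 'S_n) (j : 'I_n) : nat := (pi^-1)%g j.

Lemma position_inj (n : nat) (pi : 'S_n) : injective (position pi).
Proof. by move=> i j /val_inj /perm_inj. Qed.

(** Reversal sends position k to n - 1 - k, so remaining weight in one order is elapsed processing
    time in the other. *)
Lemma total_upto_rev_order (R : realType) (n : nat) (w : 'I_n -> R)
    (pi : 'S_n) (j : 'I_n) :
  total_upto w (rev_order pi) j = weight_from (position pi) w j.
Proof.
have revV k : ((rev_order pi)^-1)%g k = rev_ord ((pi^-1)%g k).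
  apply: (@perm_inj _ (rev_order pi)); rewrite permKV permE /= rev_ordK.
  by rewrite permKV.
by apply: eq_bigl => i; rewrite !revV /= leq_sub2lE.
Qed.

Lemma rev_orderK (n : nat) : involutive (@rev_order n).
Proof. by move=> pi; apply/permP => k; rewrite !permE /= permE /= rev_ordK. Qed.

Lemma total_upto_homo (R : realType) (n : nat) (a : 'I_n -> R) (pi : 'S_n)
    (i j : 'I_n) : (forall k, 0 <= a k) -> (position pi i <= position pi j)%N ->
  total_upto a pi i <= total_upto a pi j.
Proof.
move=> a0 ij; rewrite /total_upto [leLHS]big_mkcond [leRHS]big_mkcond /=.
apply: ler_sum => k _; case: ifP => [ki|_]; last by case: ifP.
by rewrite (leq_trans ki).
Qed.

(** * Optimal value of a fixed order *)

Section Schedules.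
Variables (R : realType) (n : nat) (alpha : R) (v w : 'I_n -> R).
Hypotheses (alpha_gt1 : 1 < alpha).
Hypotheses (v_ge0 : forall j, 0 <= v j) (w_ge0 : forall j, 0 <= w j).
Implicit Types (pi : 'S_n) (s : R -> R) (E lam : R).

Let beta : R := (alpha - 1) / alpha.

(** The quantity [A] that governs the optimal value of the order [pi]. *)
Definition reduced_cost pi : R :=
  \sum_j v j * weight_from (position pi) w j `^ beta.

Lemma reduced_cost_rev_order pi :
  unit_speed_cost (fun C : R => C `^ beta) w v (rev_order pi) = reduced_cost pi.
Proof. by apply: eq_bigr => j _; rewrite total_upto_rev_order. Qed.

Lemma reduced_cost_ge0 pi : 0 <= reduced_cost pi.
Proof. by apply: sumr_ge0 => j _; rewrite mulr_ge0 ?powR_ge0. Qed.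

Lemma completion_time_ge0 pi s j : (0 <= completion_time v pi s j)%E.
Proof. by apply: le_ereal_inf_tmp => _ [t [t0 _] <-]; rewrite lee_fin. Qed.

Lemma completion_time_homo pi s i j : (position pi i <= position pi j)%N ->
  (completion_time v pi s i <= completion_time v pi s j)%E.
Proof.
move=> ij; apply: ereal_inf_le_tmp => _ [t [t0 tj] <-]; exists t => //; split=> //.
by apply: le_trans tj; rewrite lee_fin total_upto_homo.
Qed.

(* The completion times are infima of times at which enough work has been done;
   the margin [eps] yields such times without continuity of the work. *)
Lemma cost_lower_bound pi s E lam eps : 0 < lam -> 0 < eps ->
    feasible (fun x : R => x `^ alpha) E v w pi s ->
  alpha * lam `^ (alpha - 1) * reduced_cost pi <=
  E + (alpha - 1) * lam `^ alpha *
      \sum_j w j * (fine (completion_time v pi s j) + eps).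
Proof.
move=> lam0 eps0 [ms s0 sE sC].
have beta_gt0 : 0 < beta by rewrite divr_gt0 ?subr_gt0 // (lt_trans ltr01).
pose p := position pi; have p_inj : injective p by exact: position_inj.
pose C j := completion_time v pi s j; pose T j := fine (C j) + eps.
(* Coefficients of the power [beta] of the remaining weight on the indicators of the intervals [0,
   [T j]]. *)
pose a j := increment p (fun x => x `^ beta) w j.
pose b := alpha * lam `^ (alpha - 1).
pose c := (alpha - 1) * lam `^ alpha.
have b0 : 0 <= b by rewrite mulr_ge0 ?powR_ge0 // (le_trans ler01) ?ltW.
have c0 : 0 <= c by rewrite mulr_ge0 ?powR_ge0 // ?subr_ge0 ltW.
have a0 j : 0 <= a j.
  apply: increment_ge0 => // x y x0 xy; apply: ge0_ler_powR => //.
  - exact: ltW.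
  - by rewrite nnegrE (le_trans x0).
have C_fin j : w j != 0 -> C j = (fine (C j))%:E.
  move=> wj; rewrite fineK // ge0_fin_numE ?completion_time_ge0 //.
  by apply: sC; rewrite lt_def wj w_ge0.
have T0 j : 0 <= T j by rewrite addr_ge0 ?fine_ge0 ?completion_time_ge0 // ltW.
have aE x : 0 <= x -> \sum_j a j * \1_(`[0%R, T j] : set R) x =
    (\sum_j w j * \1_(`[0%R, T j] : set R) x) `^ beta.
  (* The predicate uses the extended real [C j]: [fine] sends [+oo] to 0, so [T] may fail to be
     monotone when a job of weight 0 is never completed. *)
  move=> x0; apply: (@sum_increment_indicator _ _ p p_inj (fun x => x `^ beta) w
    (fun j => x%:E <= C j + eps%:E)%E).
  - by rewrite powR0 // gt_eqF.
  - move=> i j ij /le_trans; apply; apply: leeD => //.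
    exact: completion_time_homo.
  - move=> j /C_fin Cj; rewrite indicE; congr (nat_of_bool _)%:R.
    by rewrite Cj -EFinD lee_fin mem_setE in_itv /= x0.
pose D : set R := [set` `[0, +oo[].
have mD : measurable D by exact: measurable_itv.
have D0 x : D x -> 0 <= x by rewrite /D /= in_itv /= andbT.
have int1 : (\int[lebesgue_measure]_(x in D)
    (\sum_j b * a j * \1_(`[0%R, T j] : set R) x * s x)%:E =
    \sum_j (b * a j)%:E * work_done s (T j))%E.
  rewrite integral_sum_indic_itv //.
  - by apply: eq_bigr => j _; rewrite setI_itv0y_itv0.
  - by move=> x /D0 /s0.
  - by move=> j; rewrite mulr_ge0.
have int2 : (\int[lebesgue_measure]_(x in D)
    (\sum_j c * w j * \1_(`[0%R, T j] : set R) x * 1)%:E =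
    (\sum_j c * w j * T j)%:E)%E.
  rewrite integral_sum_indic_itv //; last by move=> j; rewrite mulr_ge0.
  rewrite -sumEFin; apply: eq_bigr => j _.
  by rewrite setI_itv0y_itv0 integral_itv0_cst1.
have work_T j :
    (* For positive weight, [T j] exceeds the infimum [C j], so enough work is done at some time
       before [T j]; for weight 0, [a j] vanishes. *)
    ((a j * total_upto v pi j)%:E <= (a j)%:E * work_done s (T j))%E.
  have [wj|wj] := eqVneq (w j) 0; first by rewrite /a increment0 // mul0r mul0e.
  rewrite EFinM lee_wpmul2l ?lee_fin //.
  have /ereal_inf_lt[_ [t [t0 tj] <-] tT] : (C j < (T j)%:E)%E.
    by rewrite C_fin // lte_fin ltrDl.
  apply: le_trans tj _; apply: le_work_done => //.
  by rewrite ltW // -lte_fin.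
have sum_work : b * reduced_cost pi = \sum_j b * (a j * total_upto v pi j).
  rewrite -mulr_sumr; congr (_ * _).
  under [RHS]eq_bigr => j _.
    rewrite /total_upto (eq_bigl (fun i => (p i <= p j)%N && true)); last first.
      by move=> i; rewrite andbT.
    over.
  by rewrite sum_increment_exchange // powR0 // gt_eqF.
have msD : measurable_fun D (fun x => s x `^ alpha).
  exact: (measurableT_comp (measurable_powR alpha) ms).
have mstep (h : 'I_n -> R) (g : R -> R) : measurable_fun D g ->
    measurable_fun D (fun x => \sum_j h j * \1_(`[0%R, T j] : set R) x * g x).
  move=> mg; apply: measurable_sum => j; apply: measurable_funM => //.
  by apply: measurable_funM => //.
rewrite -lee_fin sum_work -sumEFin.
apply: (@le_trans _ _ (\sum_j (b * a j)%:E * work_done s (T j))%E).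
  apply: lee_sum => j _; rewrite EFinM (EFinM b) -muleA lee_wpmul2l ?lee_fin //.
rewrite -int1.
(* Young's inequality is applied at each time [x], with W the total weight of the jobs such that
   [x <= T j]. *)
apply: (@le_trans _ _ (\int[lebesgue_measure]_(x in D) ((s x `^ alpha)%:E +
    (\sum_j c * w j * \1_(`[0%R, T j] : set R) x * 1)%:E))%E).
  apply: ge0_le_integral => //.
  - move=> x /D0 x0; rewrite lee_fin sumr_ge0 // => j _.
    by rewrite mulr_ge0 ?s0 // mulr_ge0 // mulr_ge0.
  - by apply/measurable_EFinP; apply: mstep.
  - by apply: emeasurable_funD; apply/measurable_EFinP => //; apply: mstep.
  - move=> x /D0 x0; rewrite -EFinD lee_fin.
    rewrite -mulr_suml; under eq_bigr do rewrite -mulrA.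
    rewrite -mulr_sumr aE //.
    under [X in _ <= _ + X]eq_bigr do rewrite mulr1 -mulrA.
    rewrite -mulr_sumr -mulrA; apply: power_tangent => //; last exact: s0.
    by apply: sumr_ge0 => j _; rewrite mulr_ge0.
rewrite ge0_integralD //.
- rewrite int2 EFinD; apply: leeD; first exact: sE.
  by rewrite lee_fin mulr_sumr; under eq_bigr do rewrite -mulrA.
- by move=> x _; rewrite lee_fin powR_ge0.
- exact/measurable_EFinP.
- move=> x _; rewrite lee_fin sumr_ge0 // => j _.
  by rewrite mulr1 mulr_ge0 // mulr_ge0.
- by apply/measurable_EFinP; apply: mstep.
Qed.
(** Feasibility makes completion times finite at positive weight, and at weight 0 the product with
    [+oo] is 0, so [fine] loses nothing. *)
Lemma weighted_completion_fin pi s E :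
    feasible (fun x : R => x `^ alpha) E v w pi s ->
  weighted_completion v w pi s =
  (\sum_j w j * fine (completion_time v pi s j))%:E.
Proof.
move=> [_ _ _ sC]; rewrite -sumEFin; apply: eq_bigr => j _.
have [->|wj] := eqVneq (w j) 0; first by rewrite mul0r mul0e.
rewrite EFinM fineK // ge0_fin_numE ?completion_time_ge0 //.
by apply: sC; rewrite lt_def wj w_ge0.
Qed.

(** When lam^(alpha-1) A = E, subtracting the energy from the lower bound leaves a common factor
    (alpha-1) lam^(alpha-1) to cancel, and the margin is then made arbitrarily small. When [A = 0],
    nonnegativity of the objective suffices. *)
Lemma weighted_completion_ge pi s E lam A : 0 < lam ->
    A <= reduced_cost pi -> A = 0 \/ lam `^ (alpha - 1) * A = E ->
    feasible (fun x : R => x `^ alpha) E v w pi s ->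
  ((A / lam)%:E <= weighted_completion v w pi s)%E.
Proof.
move=> lam0 A_le AE s_feas; rewrite (weighted_completion_fin s_feas) lee_fin.
case: AE => [->|AE].
  by rewrite mul0r sumr_ge0 // => j _; rewrite mulr_ge0 ?fine_ge0 ?completion_time_ge0.
have sw0 : 0 <= \sum_j w j by apply: sumr_ge0.
apply/ler_addgt0Pr => e e0.
(* The margin [e / (1 + \sum_j w j)] adds at most [e] to the objective; the 1 keeps the denominator
   positive when all weights are 0. *)
have sw1 : 0 < 1 + \sum_j w j by rewrite ltr_pwDl.
have eps0 : 0 < e / (1 + \sum_j w j) by rewrite divr_gt0.
have a_gt0 : 0 < alpha by exact: lt_trans alpha_gt1.
have aA : alpha * lam `^ (alpha - 1) * A <=
    alpha * lam `^ (alpha - 1) * reduced_cost pi.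
  by rewrite ler_pM2l // mulr_gt0 ?powR_gt0.
have := le_trans aA (cost_lower_bound lam0 eps0 s_feas).
have a10 : 0 < alpha - 1 by rewrite subr_gt0.
have lam_alpha : lam `^ alpha = lam * lam `^ (alpha - 1).
  by rewrite mulr_powRB1 // ltW.
have l0 : 0 < (alpha - 1) * lam `^ (alpha - 1) by rewrite mulr_gt0 ?powR_gt0.
rewrite -AE lam_alpha -lerBlDl.
set S := \sum_j w j * (_ + _).
have -> : alpha * lam `^ (alpha - 1) * A - lam `^ (alpha - 1) * A =
    (alpha - 1) * lam `^ (alpha - 1) * A by ring.
have -> : (alpha - 1) * (lam * lam `^ (alpha - 1)) * S =
    (alpha - 1) * lam `^ (alpha - 1) * (S * lam) by ring.
rewrite ler_pM2l // -ler_pdivrMr // => /le_trans; apply.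
rewrite /S; under eq_bigr do rewrite mulrDr.
rewrite big_split /= lerD2l -mulr_suml mulrA ler_pdivrMr // mulrC ler_pM2l //.
by rewrite lerDr.
Qed.

(* The speed [lam * W `^ (1 / alpha)], where [W] is the total weight of the jobs
   not yet completed, written as a combination of indicators. *)
Lemma speed_profile pi lam : 0 < lam ->
  exists s, [/\ measurable_fun (`[0, +oo[ : set R) s,
    forall t, 0 <= t -> 0 <= s t,
    energy (fun x : R => x `^ alpha) s =
      (lam `^ (alpha - 1) * reduced_cost pi)%:E,
    forall j, 0 < w j -> (completion_time v pi s j < +oo)%E &
    (weighted_completion v w pi s <= (reduced_cost pi / lam)%:E)%E].
Proof.
move=> lam0.
pose p := position pi; have p_inj : injective p by exact: position_inj.
have alpha_gt0 : 0 < alpha by exact: lt_trans alpha_gt1.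
have alpha_neq0 : alpha != 0 by rewrite gt_eqF.
pose f x := lam * x `^ alpha^-1.
have f0 : f 0 = 0 by rewrite /f powR0 ?mulr0 // invr_eq0.
pose W j := weight_from p w j.
have W0 j : 0 <= W j by exact: weight_from_ge0.
pose b j := increment p f w j.
have b0 j : 0 <= b j.
  apply: increment_ge0 => // x y x0 xy; rewrite /f ler_pM2l //.
  apply: ge0_ler_powR => //; first by rewrite invr_ge0 ltW.
  by rewrite nnegrE (le_trans x0).
(* Duration of [j] at speed [f (W j)]; as division by 0 gives 0, a job with [W j = 0] takes no
   time. *)
pose d j := v j / f (W j).
have d0 j : 0 <= d j by rewrite divr_ge0 // mulr_ge0 ?powR_ge0 // ltW.
pose c j := total_upto d pi j.
have c0 j : 0 <= c j by exact: sumr_ge0.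
have c_homo i j : (p i <= p j)%N -> c i <= c j by exact: total_upto_homo.
(* By telescoping, for [x >= 0] this is [f] of the total weight of the jobs with [x <= c j]. *)
pose s x := \sum_j b j * \1_(`[0%R, c j] : set R) x.
have s_ge0 x : 0 <= s x by apply: sumr_ge0 => j _; rewrite mulr_ge0.
have ms D : measurable_fun (D : set R) s.
  apply: measurable_sum => j; apply: measurable_funM => //.
have W_neq0 j : W j != 0 -> f (W j) != 0.
  move=> Wj; rewrite mulf_neq0 ?gt_eqF //.
  by rewrite powR_gt0 // lt_def Wj W0.
have sE x : 0 <= x ->
    s x `^ alpha = lam `^ alpha * \sum_j w j * \1_(`[0%R, c j] : set R) x.
  move=> x0.
  rewrite /s (@sum_increment_indicator _ _ p p_inj f w (fun j => x <= c j)) //.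
  - rewrite /f powRM ?powR_ge0 ?(ltW lam0) // -powRrM mulVf // powRr1 //.
    by apply: sumr_ge0 => j _; rewrite mulr_ge0.
  - by move=> i j ij /le_trans; apply; exact: c_homo.
  - by move=> j _; rewrite indicE mem_setE in_itv /= x0.
(* Dividing W by the speed lam W^(1/alpha) leaves W^beta / lam, because beta = 1 - 1/alpha; both
   sides vanish when [W j = 0]. *)
have dW j : d j * W j = v j * W j `^ beta / lam.
  have [Wj|Wj] := eqVneq (W j) 0.
    rewrite Wj powR0 ?mulr0 ?mul0r //.
    by rewrite mulf_neq0 ?invr_eq0 // subr_eq0 gt_eqF.
  have beta1 : beta = 1 - alpha^-1 by rewrite /beta mulrBl divff // mul1r.
  rewrite beta1 powRB; last by rewrite Wj implybT.
  rewrite powRr1 // /d /f invfM; ring.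
have sum_wc : \sum_j w j * c j = reduced_cost pi / lam.
  have -> : reduced_cost pi / lam = \sum_j d j * W j.
    by rewrite /reduced_cost mulr_suml; apply: eq_bigr => j _; rewrite dW.
  rewrite -(@sum_increment_exchange _ _ p p_inj id w d xpredT) //.
  apply: eq_bigr => j _; rewrite increment_id //; congr (_ * _).
  by apply: eq_bigl => i; rewrite andbT.
have energyE : energy (fun x : R => x `^ alpha) s =
    (lam `^ (alpha - 1) * reduced_cost pi)%:E.
  rewrite /energy.
  transitivity (\int[lebesgue_measure]_(x in `[0%R, +oo[)
    (\sum_j lam `^ alpha * w j * \1_(`[0%R, c j] : set R) x * 1)%:E)%E.
    apply: eq_integral => x; rewrite inE /= in_itv /= andbT => x0; congr _%:E.
    by rewrite sE // mulr_sumr; apply: eq_bigr => j _; rewrite mulr1 mulrA.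
  rewrite integral_sum_indic_itv //; last first.
    by move=> j; rewrite mulr_ge0 ?powR_ge0.
  under eq_bigr => j _ do
    rewrite setI_itv0y_itv0 integral_itv0_cst1 // -EFinM -mulrA.
  rewrite sumEFin -mulr_sumr sum_wc -(mulr_powRB1 (ltW lam0) alpha_gt0).
  by congr _%:E; field; rewrite gt_eqF.
have workE k : 0 < w k -> work_done s (c k) = (total_upto v pi k)%:E.
  move=> wk; rewrite /work_done.
  have -> : s = fun x => \sum_j b j * \1_(`[0%R, c j] : set R) x * 1.
    by apply/funext => x; apply: eq_bigr => j _; rewrite mulr1.
  rewrite integral_sum_indic_itv //.
  (* The minimum of [c j] and [c k] is the total duration of the jobs at or before both [j] and
     [k]. *)
  transitivity (\sum_j b j * \sum_(i | (p i <= p j)%N && (p i <= p k)%N) d i)%:E.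
    rewrite -sumEFin; apply: eq_bigr => j _; rewrite EFinM; congr (_ * _)%E.
    have -> : [set` `[0, c k]] `&` [set` `[0, c j]] =
        [set` `[0, Num.min (c j) (c k)]] :> set R.
      apply/seteqP; split => x /=; rewrite !in_itv /= le_min.
        by case=> /andP[-> ->] /andP[_ ->].
      by case/andP=> -> /andP[-> ->].
    rewrite integral_itv0_cst1 ?le_min ?c0 //; congr _%:E.
    have [jk|kj] := leqP (p j) (p k).
      rewrite min_l ?c_homo //; apply: eq_bigl => i.
      by rewrite andb_idr // => /leq_trans; apply.
    rewrite min_r ?c_homo 1?ltnW //; apply: eq_bigl => i.
    by rewrite andb_idl // => /leq_trans; apply; exact: ltnW.
  (* Each [i] up to [k] contributes [d i * f (W i) = v i], where [W i] is nonzero because it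
     includes [w k]. *)
  congr _%:E; rewrite sum_increment_exchange //; apply: eq_bigr => i ik.
  rewrite -/(W i) /d divfK // W_neq0 // gt_eqF //.
  by apply: (lt_le_trans wk); apply: weight_from_le.
have C_le j : 0 < w j -> (completion_time v pi s j <= (c j)%:E)%E.
  by move=> /workE wj; apply: ereal_inf_lbound; exists (c j) => //; split; rewrite ?wj.
exists s; split => //.
- by move=> j /C_le /le_lt_trans; apply; exact: ltry.
- rewrite -sum_wc -sumEFin; apply: lee_sum => j _.
  have [->|wj] := eqVneq (w j) 0; first by rewrite mul0r mul0e.
  rewrite EFinM lee_wpmul2l ?lee_fin // C_le // lt_def wj w_ge0 //.
Qed.

(** A single [lam], fixed by the minimal reduced cost [A] and by [E], serves all orders: the profile
    for [pi] costs at most [A / lam], and no feasible solution in any order costs less. *)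
Lemma universal_sequence_of_optimal pi :
  (forall sigma : 'S_n, reduced_cost pi <= reduced_cost sigma) ->
  universal_sequence (fun x : R => x `^ alpha) v w pi.
Proof.
move=> pi_opt E E0; set A := reduced_cost pi.
have a10 : alpha - 1 != 0 by rewrite subr_eq0 gt_eqF.
have [lam lam0 lamE] : exists2 lam, 0 < lam &
    A = 0 \/ lam `^ (alpha - 1) * A = E.
  (* If [A = 0], the profile consumes no energy whatever [lam] is; otherwise [lam] solves
     lam^(alpha-1) A = E. *)
  have [A0|A_neq0] := eqVneq A 0; first by exists 1 => //; left.
  have A0 : 0 < A by rewrite lt_def A_neq0 reduced_cost_ge0.
  exists ((E / A) `^ (alpha - 1)^-1); first by rewrite powR_gt0 // divr_gt0.
  by right; rewrite -powRrM mulVf // powRr1 ?divfK // divr_ge0 // ltW.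
have [s [ms s0 sE sC cost_s]] := speed_profile pi lam0.
exists s; split.
  split=> //; rewrite sE lee_fin -/A.
  by case: lamE => [->|->//]; rewrite mulr0 ltW.
move=> sigma u u_feas; apply: le_trans cost_s _.
exact: (weighted_completion_ge lam0 (pi_opt sigma) lamE u_feas).
Qed.

End Schedules.

(** * From the unit-speed problem to universal sequences *)

Theorem theorem3 (R : realType) (n : nat) (alpha : R) (v w : 'I_n -> R)
    (halpha : 1 < alpha)
    (hv : forall j, 0 <= v j) (hw : forall j, 0 <= w j) :
  (exists pi : 'S_n,
     universal_sequence (fun x : R => x `^ alpha) v w pi /\
     exists pi' : 'S_n,
       unit_speed_optimal (fun C : R => C `^ ((alpha - 1) / alpha)) w v pi' /\
       pi = rev_order pi') /\
  (forall pi' : 'S_n,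
     unit_speed_optimal (fun C : R => C `^ ((alpha - 1) / alpha)) w v pi' ->
     universal_sequence (fun x : R => x `^ alpha) v w (rev_order pi')).

Proof.
have optimal pi' : unit_speed_optimal (fun C : R => C `^ ((alpha - 1) / alpha)) w v pi' ->
    universal_sequence (fun x : R => x `^ alpha) v w (rev_order pi').
  move=> opt; apply: universal_sequence_of_optimal => // sigma.
  (* Reversal is an involution, so the optimality of [pi'] is compared with the order
     [rev_order sigma]. *)
  by rewrite -!reduced_cost_rev_order rev_orderK; apply: opt.
split; last exact: optimal.
pose cost := unit_speed_cost (fun C : R => C `^ ((alpha - 1) / alpha)) w v.
have [pi' _ pi'_min] := arg_minP cost (isT : xpredT (1%g : 'S_n)).
have pi'_opt : unit_speed_optimal (fun C : R => C `^ ((alpha - 1) / alpha)) w v pi'.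
  by move=> sigma; apply: pi'_min.
exists (rev_order pi'); split; first exact: optimal.
by exists pi'.
Qed.
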